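(* Let $K$ be a compact metric space and let $T: X\rightarrow C(K)$ be a bounded linear operator from a Banach space $X$ to the space $C(K)$ of continuous functions on $K$ (with the supremum norm). Assume that there exists a normalized sequence $(x_n)_{n\in\mathbb N}$ in $X$ (that is, $\|x_n\|=1$ for all $n$) such that $T(x_n)$ converges pointwise on $K$ to some function $H:K\to\mathbb C$ which has a discontinuity of height $h>0$ at some point $t_0\in K$. Then $$\|T\|_{e,w}\ge\frac{h}{2}.$$
   Context: For a bounded operator $T:X\to Y$ between Banach spaces, $\|T\|_{e,w}=\inf\{\|T-S\|: S:X\to Y \text{ weakly compact}\}$, where an operator is weakly compact if the image of the unit ball is relatively weakly compact. For a metric space $K$, a function $H:K\to\mathbb C$ has a discontinuity at the point $t_0\in K$ with height $h>0$ if $\limsup_{\delta\to0}\operatorname{diam}\big(H(B(t_0,\delta))\big)\ge h$, where $B(t_0,\delta)$ is the open ball centered at $t_0$ with radius $\delta$. Equivalently, there are two sequences $(s_n)$ and $(s'_n)$ in $K$, both converging to $t_0$, with $\limsup_{n}|H(s_n)-H(s'_n)|\ge h$. *)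

(* Defs.v *)
From HB Require Import structures.
From mathcomp Require Import all_boot all_order all_algebra.
From mathcomp Require Import complex.
From mathcomp Require Import all_classical all_reals all_analysis.

Set Implicit Arguments.
Unset Strict Implicit.
Unset Printing Implicit Defensive.

Import Order.TTheory GRing.Theory Num.Theory.
Import numFieldNormedType.Exports.

Local Open Scope classical_set_scope.
Local Open Scope ring_scope.
Local Open Scope complex_scope.

(* The library puts the usual norm and topology on the regular module
   [R[i]^o]; they are made available on [R[i]] itself. *)
HB.instance Definition _ (R : realType) := GRing.ComAlgebra.copy R[i] R[i]^o.
HB.instance Definition _ (R : realType) := NormedModule.copy R[i] R[i]^o.

(* Norms over [R[i]] take their values in [R[i]]; [rnorm x] is [`|x|] as an
   element of [R]. *)
Definition rnorm (R : realType) (V : normedModType R[i]) (x : V) : R :=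
  complex.Re `|x|.

Section rnorm_lemmas.
Context {R : realType} {V : normedModType R[i]}.
Implicit Types x y : V.

Lemma rnormE x : (rnorm x)%:C = `|x|.
Proof. by rewrite /rnorm RRe_real //; exact: ger0_real. Qed.

Lemma rnorm_ge0 x : 0 <= rnorm x.
Proof. by rewrite -lecR rnormE; exact: normr_ge0. Qed.

Lemma rnormD x y : rnorm (x + y) <= rnorm x + rnorm y.
Proof. by rewrite -lecR rmorphD/= !rnormE ler_normD. Qed.

Lemma rnormZ (a : R[i]) x : rnorm (a *: x) = rnorm a * rnorm x.
Proof. by apply: complexI; rewrite rmorphM/= !rnormE normrZ. Qed.

Lemma rnorm_eq0 x : rnorm x = 0 -> x = 0.
Proof. by move=> x0; apply/normr0_eq0; rewrite -rnormE x0. Qed.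

Lemma rnorm_continuous : continuous (@rnorm R V).
Proof.
move=> x; apply/cvgrPdist_lt => e e0.
have eC0 : 0 < e%:C by rewrite ltcR.
have /cvgrPdist_lt/(_ _ eC0) : y @[y --> x] --> x by [].
apply: filterS => y; rewrite -rnormE ltcR; apply: le_lt_trans.
have tri (a b : V) : rnorm a - rnorm b <= rnorm (a - b).
  by rewrite lerBlDr -{1}(subrK b a) rnormD.
rewrite ler_norml lerNl opprB tri andbT.
by rewrite (_ : rnorm (x - y) = rnorm (y - x)) ?tri// /rnorm distrC.
Qed.

End rnorm_lemmas.

(* Compact metric spaces; the empty space is allowed. *)
HB.mixin Record Topological_isCompact M & Topological M := {
  compact_setT : compact [set: M]
}.

#[short(type="compactMetricType")]
HB.structure Definition CompactMetric (R : numDomainType) :=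
  { M of Metric R M & Topological_isCompact M }.

Section continuous_functions.
Context {R : realType} (K : compactMetricType R).

(* C(K) with the supremum norm, as a normed space over [R[i]] *)
Definition cfun := continuousType K R[i].
Identity Coercion cfun_to_continuousType : cfun >-> Continuous.type.

HB.instance Definition _ := Choice.copy cfun (continuousType K R[i]).

Implicit Types f g : cfun.

Let cfun_eq f g : f =1 g -> f = g.
Proof. by move/continuousEP. Qed.

Fact cfun0_subproof : continuous (fun _ : K => 0 : R[i]).
Proof. by move=> t; exact: cvg_cst. Qed.
Fact cfunN_subproof f : continuous (fun t => - f t).
Proof. by move=> t; apply: cvgN; exact: cts_fun. Qed.
Fact cfunD_subproof f g : continuous (fun t => f t + g t).
Proof. by move=> t; apply: cvgD; exact: cts_fun. Qed.
Fact cfunZ_subproof (a : R[i]) f : continuous (fun t => a * f t).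
Proof. by move=> t; apply: cvgMl_tmp; exact: cts_fun. Qed.

Definition cfun0 : cfun := mkcts cfun0_subproof.
Definition cfunN f : cfun := mkcts (@cfunN_subproof f).
Definition cfunD f g : cfun := mkcts (@cfunD_subproof f g).
Definition cfunZ (a : R[i]) f : cfun := mkcts (@cfunZ_subproof a f).

Let cfunDA : associative cfunD.
Proof. by move=> f g k; apply: cfun_eq => t; exact: addrA. Qed.
Let cfunDC : commutative cfunD.
Proof. by move=> f g; apply: cfun_eq => t; exact: addrC. Qed.
Let cfun0D : left_id cfun0 cfunD.
Proof. by move=> f; apply: cfun_eq => t; exact: add0r. Qed.
Let cfunND : left_inverse cfun0 cfunN cfunD.
Proof. by move=> f; apply: cfun_eq => t; exact: addNr. Qed.

HB.instance Definition _ :=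
  GRing.isZmodule.Build cfun cfunDA cfunDC cfun0D cfunND.

Let cfunZA a b f : cfunZ a (cfunZ b f) = cfunZ (a * b) f.
Proof. by apply: cfun_eq => t; exact: mulrA. Qed.
Let cfun1Z : left_id 1 cfunZ.
Proof. by move=> f; apply: cfun_eq => t; exact: mul1r. Qed.
Let cfunZDr : right_distributive cfunZ +%R.
Proof. by move=> a f g; apply: cfun_eq => t; exact: mulrDr. Qed.
Let cfunZDl f : {morph cfunZ^~ f : a b / a + b}.
Proof. by move=> a b; apply: cfun_eq => t; exact: mulrDl. Qed.

HB.instance Definition _ :=
  GRing.Zmodule_isLmodule.Build R[i] cfun cfunZA cfun1Z cfunZDr cfunZDl.

Definition supnorm f : R := sup [set rnorm (f t) | t in [set: K]].

Lemma supnorm_has_ubound f : has_ubound [set rnorm (f t) | t in [set: K]].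
Proof.
have : compact [set rnorm (f t) | t in [set: K]].
  apply: continuous_compact; last exact: compact_setT.
  apply: continuous_subspaceT => t.
  apply: continuous_comp; [exact: cts_fun | exact: rnorm_continuous].
move=> /compact_bounded /pinfty_ex_gt0[M M0 fM].
by exists M => _ [t _ <-]; apply: (le_trans (ler_norm _)); apply: fM; exists t.
Qed.

Lemma rnorm_le_supnorm f t : rnorm (f t) <= supnorm f.
Proof. by apply: ub_le_sup; [exact: supnorm_has_ubound | exists t]. Qed.

Lemma supnorm_ge0 f : 0 <= supnorm f.
Proof.
rewrite /supnorm.
have [->|/set0P[_ [t _ _]]] := eqVneq [set rnorm (f t) | t in [set: K]] set0.
  by rewrite sup0.
exact: le_trans (rnorm_ge0 (f t)) (rnorm_le_supnorm f t).
Qed.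

Lemma supnorm_le f (M : R) :
  0 <= M -> (forall t, rnorm (f t) <= M) -> supnorm f <= M.
Proof.
move=> M0 fM; rewrite /supnorm.
have [->|f0] := eqVneq [set rnorm (f t) | t in [set: K]] set0.
  by rewrite sup0.
by apply: ge_sup; [exact/set0P | move=> _ [t _ <-]].
Qed.

Let supnormD f g : (supnorm (f + g))%:C <= (supnorm f)%:C + (supnorm g)%:C.
Proof.
rewrite -rmorphD lecR; apply: supnorm_le => [|t].
  by rewrite addr_ge0 ?supnorm_ge0.
by rewrite (le_trans (rnormD _ _))// lerD ?rnorm_le_supnorm.
Qed.

Let supnormZ (a : R[i]) f : (supnorm (a *: f))%:C = `|a| * (supnorm f)%:C.
Proof.
rewrite -rnormE -rmorphM/=; congr _%:C; apply/eqP; rewrite eq_le.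
have le_supZ (b : R[i]) g : supnorm (b *: g) <= rnorm b * supnorm g.
  apply: supnorm_le => [|t]; first by rewrite mulr_ge0 ?rnorm_ge0 ?supnorm_ge0.
  by rewrite (rnormZ b (g t)) ler_wpM2l ?rnorm_ge0 ?rnorm_le_supnorm.
rewrite le_supZ/=; have [->|a0] := eqVneq a 0.
  rewrite (_ : rnorm 0 = 0) ?mul0r ?supnorm_ge0//.
  by apply: complexI; rewrite rnormE normr0.
have ra0 : 0 < rnorm a.
  by rewrite lt_neqAle rnorm_ge0 andbT eq_sym; apply: contra a0 => /eqP/rnorm_eq0->.
rewrite -ler_pdivlMl//; have := le_supZ a^-1 (a *: f).
rewrite scalerA mulVf// scale1r; congr (_ <= _ * _).
by apply: complexI; rewrite rnormE normfV fmorphV/= rnormE.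
Qed.

Let supnorm_eq0 f : (supnorm f)%:C = 0 -> f = 0.
Proof.
move=> /complexI f0; apply: cfun_eq => t; apply: rnorm_eq0; apply/eqP.
by rewrite eq_le rnorm_ge0 -f0 rnorm_le_supnorm.
Qed.

HB.instance Definition _ :=
  Lmodule_isNormed.Build R[i] cfun supnormD supnormZ supnorm_eq0.

End continuous_functions.

Section operators.
Context {R : realType}.
Implicit Types X Y : normedModType R[i].

Definition unit_ball X : set X := [set x | rnorm x <= 1].

(* [sup] and [inf] in [R] have junk values on unbounded or empty sets: [opnorm]
   is meant for bounded operators, and in [ess_wnorm] the operator [T] is meant
   to be bounded; the infimum is over a set of nonnegative reals that contains
   [opnorm T] (take [S = 0]). *)
Definition opnorm X Y (f : X -> Y) : R :=
  sup [set rnorm (f x) | x in @unit_ball X].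

Definition dual Y := {phi : {linear Y -> R[i]} | bounded_near phi (nbhs (0 : Y))}.

Definition dual_eval Y (y : Y) : {ptws dual Y -> R[i]} :=
  fun phi => sval phi y.

(* [Y] with its weak topology: the initial topology for evaluation against the
   bounded linear functionals, with pointwise convergence on the dual. *)
Definition weak Y := initial_topology (@dual_eval Y).

HB.instance Definition _ Y :=
  Topological.copy (weak Y) (initial_topology (@dual_eval Y)).

Definition weakly_compact X Y (S : X -> Y) :=
  precompact (S @` @unit_ball X : set (weak Y)).

Definition ess_wnorm X Y (T : X -> Y) : R :=
  inf [set opnorm (T \- S) | S in [set S : {linear X -> Y} |
        bounded_near S (nbhs (0 : X)) /\ weakly_compact S]].

End operators.

Section discontinuity.
Context {R : realType}.

(* extended-real diameter; [-oo] on the empty set *)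
Definition ediam (V : normedModType R[i]) (A : set V) : \bar R :=
  ereal_sup [set (rnorm (x - y))%:E | x in A & y in A].

Definition discontinuity_height (K : metricType R) (H : K -> R[i]) (t0 : K)
    (h : R) : Prop :=
  (h%:E <= limf_esup (fun d : R => ediam (H @` ball t0 d)) 0^'+)%E.

End discontinuity.

(* Main.v *)
Require Import Defs.
From HB Require Import structures.
From mathcomp Require Import all_boot all_order all_algebra complex.
From mathcomp Require Import all_classical all_reals all_analysis.
Import Order.TTheory GRing.Theory Num.Theory numFieldNormedType.Exports.
Local Open Scope classical_set_scope.
Local Open Scope ring_scope.
Local Open Scope complex_scope.

(** Let [S] be weakly compact and [c] the norm of [T - S]. The sequence [S x_n]
lies in a relatively weakly compact subset of [C(K)], so it has a weak cluster
point [g], which is a continuous function. Evaluation at [t] is a bounded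
functional, so [g t] is a cluster point of the scalars [S x_n t]
([weakly_compact_pointwise_cluster]); these stay within [c] of [T x_n t], which
converges to [H t]. Hence [|H t - g t| <= c] at every [t].

A function at uniform distance at most [c] from a continuous one oscillates by
at most [2c] at each point ([discontinuity_height_le]), so [h <= 2c]. The bound
[h / 2] therefore holds for each term of the infimum that defines the essential
norm.

As infima and suprema in [R] have a default value, it also has to be shown that
the infimum is over a nonempty set, which holds because the zero operator is
weakly compact ([weakly_compact0]), and that the suprema giving [c] are over
bounded sets ([rnorm_le_opnormB]). *)

Lemma rnormB (R : realType) (V : normedModType R[i]) (x y : V) :
  rnorm (x - y) = rnorm (y - x).
Proof. by rewrite /rnorm distrC. Qed.

Lemma bounded_linear_rnorm (R : realType) (X Y : normedModType R[i])
    (f : {linear X -> Y}) :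
  bounded_near f (nbhs (0 : X)) ->
  exists M : R, forall x, rnorm (f x) <= M * rnorm x.
Proof.
move=> /linear_boundedP /pinfty_ex_gt0[M M0 fM].
exists (complex.Re M) => x.
have ME : (complex.Re M)%:C = M by rewrite RRe_real ?gtr0_real.
by rewrite -lecR rnormE (le_trans (fM x))// rmorphM -rnormE -ME.
Qed.

(** Boundedness of both operators makes the supremum defining the norm of their
difference a genuine one. *)
Lemma rnorm_le_opnormB (R : realType) (X Y : normedModType R[i])
    (f g : {linear X -> Y}) (x : X) :
  bounded_near f (nbhs (0 : X)) -> bounded_near g (nbhs (0 : X)) ->
  rnorm x <= 1 -> rnorm (f x - g x) <= opnorm (f \- g).
Proof.
move=> /bounded_linear_rnorm[M fM] /bounded_linear_rnorm[N gN] x1.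
apply: ub_le_sup; last by exists x.
exists (`|M| + `|N|) => _ [y y1 <-] /=.
apply: (le_trans (rnormD _ _)).
have -> : rnorm (- g y) = rnorm (g y) by rewrite /rnorm normrN.
have bnd (L r : R) : r <= L * rnorm y -> r <= `|L|.
  move=> /le_trans; apply; apply: (@le_trans _ _ (`|L| * rnorm y)).
    by rewrite ler_wpM2r ?rnorm_ge0// ler_norm.
  by rewrite ler_piMr.
by rewrite lerD// bnd.
Qed.

Section evaluation.
Context (R : realType) (K : compactMetricType R).
Implicit Types (f g : cfun K) (t : K).

Definition eval_at t f : R[i] := f t.

Lemma eval_at_is_linear t : linear (eval_at t).
Proof. by []. Qed.

HB.instance Definition _ t :=
  GRing.isLinear.Build R[i] (cfun K) R[i] _ (eval_at t) (eval_at_is_linear t).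

Lemma eval_at_bounded t : bounded_near (eval_at t) (nbhs (0 : cfun K)).
Proof.
apply/linear_boundedP; near=> r => f.
apply: (@le_trans _ _ `|f|); last first.
  by rewrite ler_peMl ?normr_ge0//; near: r; exact: nbhs_pinfty_ge.
by rewrite -rnormE lecR rnorm_le_supnorm.
Unshelve. all: by end_near. Qed.

(** Evaluation at [t] is one of the functionals that generate the weak topology.
*)
Lemma weak_eval_continuous t : continuous (eval_at t : weak (cfun K) -> R[i]).
Proof.
pose phi : dual (cfun K) :=
  exist (fun u : {linear cfun K -> R[i]} => bounded_near u (nbhs (0 : cfun K)))
    (eval_at t) (eval_at_bounded t).
move=> f; apply: (@continuous_comp (weak (cfun K)) _ _
  (@dual_eval R (cfun K)) (fun u : {ptws dual (cfun K) -> R[i]} => u phi)).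
  exact: initial_continuous.
(* The projections of a product are continuous for an index set with decidable
   equality, which classical logic gives to the dual. *)
exact: (@proj_continuous {classic dual (cfun K)} (fun=> R[i]) phi).
Qed.

Lemma weak_eval_near g t (e : R) : 0 < e ->
  nbhs (g : weak (cfun K)) [set f : cfun K | rnorm (g t - f t) < e].
Proof.
move=> e0; have eC0 : 0 < e%:C by rewrite ltcR.
have /cvgrPdist_lt/(_ _ eC0) := weak_eval_continuous t g.
by apply: filterS => f; rewrite -rnormE ltcR.
Qed.

(** Evaluations separate the points of [C(K)] and are weakly continuous, so a
weak limit of the zero function vanishes at every [t]. *)
Lemma weakly_closed0 : closed ([set 0] : set (weak (cfun K))).
Proof.
move=> f clf; apply/continuousEP => t; apply: rnorm_eq0; apply/eqP.
rewrite eq_le rnorm_ge0 andbT; apply/ler_addgt0Pr => e e0.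
have [_ [->]] := clf _ (weak_eval_near f t e e0).
by rewrite /= subr0 add0r => /ltW.
Qed.

(** Relative compactness asks for a superset that is both compact and closed; a
singleton is always compact, and [weakly_closed0] gives the rest. *)
Lemma weakly_compact0 (X : normedModType R[i]) :
  weakly_compact (fun _ : X => 0 : cfun K).
Proof.
apply: (@precompact_subset (weak (cfun K)) _ [set 0]).
  by move=> _ [x _ <-].
by rewrite precompact_closed; [exact: compact_set1 | exact: weakly_closed0].
Qed.

(** The function [g] is a weak cluster point of [S x_n]. Its cluster property is
stated along an arbitrary eventual property [P], so that the index can be chosen
where another sequence is already close to its limit. *)
Lemma weakly_compact_pointwise_cluster (X : normedModType R[i])
    (S : X -> cfun K) (x : nat -> X) :
  weakly_compact S -> (forall n, rnorm (x n) <= 1) ->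
  exists g : cfun K, forall t (e : R) (P : nat -> Prop), 0 < e ->
    (\forall n \near \oo, P n) -> exists2 n, P n & rnorm (g t - S (x n) t) < e.
Proof.
move=> [B SB [cB _]] x1.
pose F : set_system (weak (cfun K)) := (fun n => S (x n)) @ \oo.
have FB : F B by exists 0%N => // n _; apply: SB; exists (x n) => //; exact: x1.
have [g [_ gF]] := cB F _ FB.
exists g => t e P e0 FP.
have FP' : F [set S (x n) | n in P] by apply: (filterS _ FP) => n Pn; exists n.
by have [_ [[n Pn <-] ge]] := gF _ _ FP' (weak_eval_near g t e e0); exists n.
Qed.

End evaluation.

(** The points [H s] and [H s'] are joined through [g s], [g t0] and [g s']: the
two outer steps cost [c] each, the inner ones are small by continuity of [g]. *)
Lemma discontinuity_height_le (R : realType) (K : metricType R)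
    (H g : K -> R[i]) (t0 : K) (c h : R) :
  {for t0, continuous g} -> (forall t, rnorm (H t - g t) <= c) ->
  discontinuity_height H t0 h -> h <= c + c.
Proof.
move=> gc Hg Hh; apply/ler_addgt0Pr => e e0.
have eC0 : 0 < (e / 2)%:C by rewrite ltcR divr_gt0.
have /cvgrPdist_lt/(_ _ eC0)/nbhs_ballP[d /= d0 dg] := gc.
rewrite -lee_fin; apply: (le_trans Hh); apply: ge_ereal_inf.
(* The limit superior is at most the supremum over the radii in ]0, d[. *)
eexists; first by exists [set r | 0 < r < d] => //; near=> r; apply/andP; split.
apply: ge_ereal_sup => _ [r /= /andP[r0 rd] <-].
apply: ge_ereal_sup => _ [_ [s sr <-]] [_ [s' sr' <-]] <-; rewrite lee_fin.
have ge2 u : ball t0 r u -> rnorm (g t0 - g u) <= e / 2.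
  by move=> /(le_ball (ltW rd))/dg/ltW; rewrite -rnormE lecR.
have [Hs Hs'] := (Hg s, Hg s'); rewrite rnormB in Hs'.
have [gs gs'] := (ge2 _ sr, ge2 _ sr'); rewrite rnormB in gs.
have -> : H s - H s' =
    (H s - g s) + ((g s - g t0) + ((g t0 - g s') + (g s' - H s'))).
  by rewrite !subrKA.
have -> : c + c + e = c + (e / 2 + (e / 2 + c)).
  by rewrite (addrA (e / 2)) -splitr addrA addrAC.
by do 3 (apply: (le_trans (rnormD _ _)); apply: lerD => //).
Unshelve. all: by end_near. Qed.

Theorem proposition3p2 (R : realType) (K : compactMetricType R)
    (X : completeNormedModType R[i]) (T : {linear X -> cfun K})
    (T_bounded : bounded_near T (nbhs (0 : X)))
    (x : nat -> X) (x_normalized : forall n, `|x n| = 1)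
    (H : K -> R[i])
    (Tx_cvg : forall t : K, (fun n => (T (x n) : cfun K) t) @ \oo --> H t)
    (t0 : K) (h : R) (h_gt0 : 0 < h)
    (H_disc : discontinuity_height H t0 h) :
  h / 2 <= ess_wnorm T.
Proof.
have x1 n : rnorm (x n) <= 1 by rewrite /rnorm x_normalized.
apply: lb_le_inf.
  (* The infimum is over a nonempty set: take [S = 0]. *)
  exists (opnorm (T \- \0)), (\0 : {linear X -> cfun K}) => //; split.
    by apply/linear_boundedP; near=> r => y; rewrite normr0 mulr_ge0.
  exact: weakly_compact0.
move=> _ [S [Sb Sw] <-].
have [g gS] := weakly_compact_pointwise_cluster R K X S x Sw x1.
suff Hg t : rnorm (H t - g t) <= opnorm (T \- S).
  rewrite ler_pdivrMr// mulr_natr mulr2n.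
  apply: discontinuity_height_le H_disc; last exact: Hg.
  exact: cts_fun.
apply/ler_addgt0Pr => e e0.
have e20 : 0 < e / 2 by rewrite divr_gt0.
have Tn : \forall n \near \oo, rnorm (H t - T (x n) t) < e / 2.
  have eC0 : 0 < (e / 2)%:C by rewrite ltcR.
  have /cvgrPdist_lt/(_ _ eC0) := Tx_cvg t.
  by apply: filterS => n; rewrite -rnormE ltcR.
have [n Hn Sn] := gS t _ _ e20 Tn.
have TS : rnorm ((T (x n) - S (x n) : cfun K) t) <= opnorm (T \- S).
  by apply: le_trans (rnorm_le_opnormB _ _ _ _ _ _ T_bounded Sb (x1 n));
     exact: rnorm_le_supnorm.
have -> : H t - g t =
    (H t - T (x n) t) + ((T (x n) - S (x n) : cfun K) t + (S (x n) t - g t)).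
  by rewrite [(_ - _ : cfun K) t]/(T (x n) t - S (x n) t) !subrKA.
have -> : opnorm (T \- S) + e = e / 2 + (opnorm (T \- S) + e / 2).
  by rewrite addrCA -splitr.
rewrite rnormB in Sn.
apply: (le_trans (rnormD _ _)); apply: lerD; first exact: ltW.
by apply: (le_trans (rnormD _ _)); apply: lerD; last exact: ltW.
Unshelve. all: by end_near. Qed.
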